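(* Let $\mathbf{X}\in\mathbb{R}^{n\times p}$ be deterministic. Assume that the noise random vector $\varepsilon$ in $\mathbb{R}^n$ is symmetric, i.e., that $\varepsilon$ and $-\varepsilon$ have the same distribution. Let $\lambda\ge 0$ be a tuning parameter, let $h(\beta)=\sqrt n\,\lambda\|\beta\|_1$ for $\beta\in\mathbb{R}^p$, and let $T\subset\{1,\dots,p\}$. If $\phi(T,1)>0$, then there exists a target vector $\beta^*\in\mathbb{R}^p$ such that $\operatorname{supp}(\beta^* )\subset T$ and $$\mathbb{P}\left(\frac{99}{100}\,\frac{\lambda\sqrt{|T|}}{\phi(T,1)}\ \le\ \|\mathbf{X}(\hat\beta-\beta^* )\|\right)\ \ge\ 0.49,$$ where $\hat\beta\in\operatorname*{argmin}_{\beta\in\mathbb{R}^p}\|\mathbf{X}\beta-y\|^2+2h(\beta)$ with $y=\mathbf{X}\beta^*+\varepsilon$.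
   Context: $\|\cdot\|$ is the Euclidean norm and $\|\cdot\|_1$ the $\ell_1$-norm. For $u\in\mathbb{R}^p$ and $T\subset\{1,\dots,p\}$, $u_T$ denotes the restriction of $u$ to the coordinates in $T$, $T^c$ the complement of $T$ in $\{1,\dots,p\}$, $|T|$ the cardinality of $T$, and $\operatorname{supp}(\beta)$ the set of indices of nonzero coordinates of $\beta$. For $T\subset\{1,\dots,p\}$ and $c_0\ge1$, the compatibility constant is $$\phi(T,c_0)=\inf_{u\in\mathbb{R}^p:\ \|u_{T^c}\|_1<c_0\|u_T\|_1}\frac{\sqrt{|T|}\,\|\mathbf{X}u\|}{\sqrt n\,\big(\|u_T\|_1-(1/c_0)\|u_{T^c}\|_1\big)}.$$ *)

(* Defs.v *)
From mathcomp Require Import all_boot all_order all_algebra.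
From mathcomp Require Import all_classical all_reals all_analysis.

Set Implicit Arguments.
Unset Strict Implicit.
Unset Printing Implicit Defensive.

Import Order.TTheory GRing.Theory Num.Theory.
Import numFieldNormedType.Exports.

Local Open Scope classical_set_scope.
Local Open Scope ring_scope.

(* The library norm on matrices is the sup norm, hence the explicit l2 norm. *)
Definition l2norm (R : realType) (k : nat) (u : 'cV[R]_k) : R :=
  Num.sqrt (\sum_(i < k) u i 0 ^+ 2).

Definition l1norm (R : realType) (k : nat) (u : 'cV[R]_k) : R :=
  \sum_(i < k) `|u i 0|.

(* The restriction u_T, extended by zero outside T. *)
Definition restr (R : realType) (p : nat) (T : {set 'I_p}) (u : 'cV[R]_p) :
    'cV[R]_p :=
  \col_i (if i \in T then u i 0 else 0).

Definition supp (R : realType) (p : nat) (u : 'cV[R]_p) : {set 'I_p} :=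
  [set i | u i 0 != 0]%SET.

(* The infimum is taken in the extended reals, so that it is +oo when no u
   satisfies the constraint, which happens exactly when T is empty (for c0 > 0). *)
Definition compat (R : realType) (n p : nat) (X : 'M[R]_(n, p))
    (T : {set 'I_p}) (c0 : R) : \bar R :=
  ereal_inf [set ((Num.sqrt #|T|%:R * l2norm (X *m u)) /
        (Num.sqrt n%:R *
         (l1norm (restr T u) - c0^-1 * l1norm (restr (~: T)%SET u))))%:E
    | u in [set u : 'cV[R]_p |
        l1norm (restr (~: T)%SET u) < c0 * l1norm (restr T u)]].

Definition lasso_pen (R : realType) (n p : nat) (lambda : R)
    (beta : 'cV[R]_p) : R :=
  Num.sqrt n%:R * lambda * l1norm beta.

Definition argmin (R : realType) (E : Type) (f : E -> R) : set E :=
  [set b | forall b', f b <= f b'].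

(* R^n with its Borel sigma-algebra. *)
Definition borel_cV (R : realType) (n : nat) : measurableType _ :=
  g_sigma_algebraType (@open 'cV[R]_n).

(* eps and - eps have the same distribution: the two image measures agree on
   the Borel sets. *)
Definition symmetric_rv (R : realType) (n : nat) (d : measure_display)
    (Omega : measurableType d) (P : probability Omega R)
    (eps : {RV P >-> borel_cV R n}) : Prop :=
  forall A : set (borel_cV R n), measurable A ->
    pushforward P (fun w => eps w : borel_cV R n) A =
    pushforward P (fun w => (- (eps w : 'cV[R]_n)) : borel_cV R n) A.

(* Main.v *)
Require Import Defs.
From mathcomp Require Import all_boot all_order all_algebra.
From mathcomp Require Import all_classical all_reals all_analysis.
From mathcomp Require Import ring lra.

Set Implicit Arguments.
Unset Strict Implicit.
Unset Printing Implicit Defensive.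

Import Order.TTheory GRing.Theory Num.Theory.
Import numFieldNormedType.Exports.

Local Open Scope classical_set_scope.
Local Open Scope ring_scope.

(* Let kappa = sqrt n (|u_T|_1 - |u_{T^c}|_1) for a near minimizer u in the
   definition of phi = phi(T,1), and take beta* = - s u_T with s large, so that
   moving from beta* by s u lowers h by exactly s lambda kappa.  Write
   z = X (bhat - beta* ) and C = lambda sqrt |T| / phi.  The variational
   inequality at bhat, tested at beta* + s u = s u_{T^c}, together with
   h(beta* ) - h(bhat) <= C |z| (definition of phi) gives
     s (z . Xu) >= s lambda kappa + s (eps . Xu) + |z|^2 - (|eps| + C) |z|,
   where the last two terms are at least - (|eps| + C)^2 / 4.  By symmetry
   eps . Xu >= 0 with probability at least 1/2, and |eps| <= k with probability
   at least 0.99 for some k.  On both events Cauchy-Schwarz and s large (in terms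
   of k) give |z| |Xu| >= 0.995 lambda kappa, that is |z| >= 0.99 C.  No sign
   pattern of bhat is used: phi > 0 does not make bhat unique. *)

(** * Euclidean inner product, Cauchy-Schwarz and continuity *)

Definition dot (R : realType) (k : nat) (u v : 'cV[R]_k) : R :=
  \sum_(i < k) u i 0 * v i 0.

Section Euclidean.
Variables (R : realType) (k : nat).
Implicit Types (u v w : 'cV[R]_k) (a : R).

Lemma dotC u v : dot u v = dot v u.
Proof. by apply: eq_bigr => i _; rewrite mulrC. Qed.

Lemma dotDl u v w : dot (u + v) w = dot u w + dot v w.
Proof. by rewrite -big_split; apply: eq_bigr => i _; rewrite mxE mulrDl. Qed.

Lemma dotZl a u v : dot (a *: u) v = a * dot u v.
Proof. by rewrite mulr_sumr; apply: eq_bigr => i _; rewrite mxE mulrA. Qed.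

Lemma dotNl u v : dot (- u) v = - dot u v.
Proof. by rewrite -scaleN1r dotZl mulN1r. Qed.

Lemma dotDr u v w : dot w (u + v) = dot w u + dot w v.
Proof. by rewrite dotC dotDl !(dotC w). Qed.

Lemma dotZr a u v : dot u (a *: v) = a * dot u v.
Proof. by rewrite dotC dotZl dotC. Qed.

Lemma dotNr u v : dot u (- v) = - dot u v.
Proof. by rewrite dotC dotNl dotC. Qed.

Definition dotE := (dotDl, dotDr, dotNl, dotNr, dotZl, dotZr).

Lemma l2norm_ge0 u : 0 <= l2norm u.
Proof. exact: sqrtr_ge0. Qed.

Lemma sqr_l2norm u : l2norm u ^+ 2 = dot u u.
Proof. by rewrite sqr_sqrtr ?sumr_ge0 // => i _; rewrite sqr_ge0. Qed.

Lemma dot_ge0 u : 0 <= dot u u.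
Proof. by rewrite -sqr_l2norm sqr_ge0. Qed.

Lemma l2norm_eq0 u : l2norm u = 0 -> u = 0.
Proof.
move=> u0; apply/matrixP => i j; rewrite ord1 mxE; apply/eqP.
have /eqP : dot u u = 0 by rewrite -sqr_l2norm u0 expr0n.
rewrite psumr_eq0 => [/allP/(_ i (mem_index_enum _))|l _]; last exact: sqr_ge0.
by rewrite /= mulf_eq0 orbb.
Qed.

(** Expand the squared norm of |v| u - |u| v; the factor 2 |u| |v| cancels once both norms are
    nonzero. *)
Lemma dot_le_l2norm u v : dot u v <= l2norm u * l2norm v.
Proof.
have [u0|u0] := eqVneq (l2norm u) 0.
  by rewrite (l2norm_eq0 u0) -(scale0r 0) dotZl mul0r mulr_ge0 ?l2norm_ge0.
have [v0|v0] := eqVneq (l2norm v) 0.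
  by rewrite (l2norm_eq0 v0) -(scale0r 0) dotZr mul0r mulr_ge0 ?l2norm_ge0.
have uv_gt0 : 0 < l2norm u * l2norm v.
  by rewrite mulr_gt0 // lt_neqAle eq_sym ?u0 ?v0 l2norm_ge0.
have := dot_ge0 (l2norm v *: u - l2norm u *: v).
rewrite !dotE (dotC v u) -!sqr_l2norm => h.
have : 0 <= 2 * (l2norm u * l2norm v) * (l2norm u * l2norm v - dot u v) by lra.
by rewrite pmulr_rge0 ?subr_ge0 // mulr_gt0.
Qed.

Lemma l2norm_triangle u v : l2norm (u + v) <= l2norm u + l2norm v.
Proof.
have h := dot_le_l2norm u v.
rewrite -(ler_pXn2r (n := 2)) ?nnegrE ?addr_ge0 ?l2norm_ge0 //.
by rewrite sqr_l2norm !dotE (dotC v u) -!sqr_l2norm; lra.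
Qed.

Lemma dot_continuous v : continuous (fun u : 'cV[R]_k => dot u v).
Proof.
apply: continuous_big => [|i _ x]; first exact: add_continuous.
apply: (@cvgM _ _ (nbhs x) _ (fun u : 'cV[R]_k => u i 0) (fun=> v i 0)); [exact: coord_continuous|exact: cvg_cst].
Qed.

Lemma l2dist_continuous v : continuous (fun u : 'cV[R]_k => l2norm (u - v)).
Proof.
have -> : (fun u : 'cV[R]_k => l2norm (u - v)) =
    (fun u => Num.sqrt (\sum_(i < k) (u i 0 - v i 0) ^+ 2)).
  by apply/funext => u; congr Num.sqrt; apply: eq_bigr => i _; rewrite !mxE.
move=> x; apply: continuous_comp; last exact: sqrt_continuous.
move: x; apply: continuous_big => [|i _ x]; first exact: add_continuous.
have cvB : {for x, continuous (fun u : 'cV[R]_k => u i 0 - v i 0)}.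
  by apply: (@cvgB _ _ _ (nbhs x) _ (fun u : 'cV[R]_k => u i 0) (fun=> v i 0)); [exact: coord_continuous|exact: cvg_cst].
exact: (cvgM cvB cvB).
Qed.

End Euclidean.

(** * The l1 norm near a vector supported in [T] *)

Section L1.
Variables (R : realType) (p : nat).
Implicit Types (u v : 'cV[R]_p) (T : {set 'I_p}).

Lemma l1normZ a u : l1norm (a *: u) = `|a| * l1norm u.
Proof. by rewrite mulr_sumr; apply: eq_bigr => i _; rewrite mxE normrM. Qed.

Lemma l1norm_triangle u v : l1norm (u + v) <= l1norm u + l1norm v.
Proof.
by rewrite -big_split; apply: ler_sum => i _; rewrite mxE; exact: ler_normD.
Qed.

(** Coordinatewise: on [T] this is the triangle inequality; off [T] the entry of [u] vanishes, so
    the difference is exactly -|v_i|. *)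
Lemma l1norm_decrease T u v : supp u \subset T ->
  l1norm u - l1norm (u + v) <= l1norm (restr T v) - l1norm (restr (~: T)%SET v).
Proof.
move=> /fintype.subsetP uT; rewrite -!sumrB; apply: ler_sum => i _.
rewrite !mxE finset.in_setC; have [iT|iT] /= := boolP (i \in T).
  by rewrite normr0 subr0 lerBlDl -[X in `|X| <= _](addrK (v i 0)) ler_normB.
have -> : u i 0 = 0.
  by apply/eqP; apply: contraNT iT => ui; apply: uT; rewrite inE.
by rewrite normr0 !add0r.
Qed.

End L1.

Lemma ler_addM_small (R : realFieldType) (a b c : R) :
  (forall t, 0 < t <= 1 -> a <= b + t * c) -> a <= b.
Proof.
move=> h; apply/ler_addgt0Pr => e e0.
(* The summand 1 keeps the divisor positive when [c] is 0, and still t |c| <= e. *)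
set t := Num.min 1 (e / (1 + `|c|)).
have c0 : 0 < 1 + `|c| by rewrite ltr_pwDl.
have t0 : 0 < t by rewrite lt_min ltr01 divr_gt0.
apply: le_trans (h t _) _; first by rewrite t0 ge_min lexx.
rewrite lerD2l; apply: le_trans (ler_norm _) _; rewrite normrM gtr0_norm //.
have : t * (1 + `|c|) <= e by rewrite -ler_pdivlMr // ge_min lexx orbT.
lra.
Qed.

(** * Lasso optimality and the deterministic lower bound *)

Section Lasso.
Variables (R : realType) (n p : nat) (X : 'M[R]_(n, p)) (lambda : R).
Hypothesis lambda_ge0 : 0 <= lambda.

Definition lasso_obj (y : 'cV[R]_n) (b : 'cV[R]_p) : R :=
  l2norm (X *m b - y) ^+ 2 + 2 * lasso_pen n lambda b.

Lemma lasso_pen_convex (t : R) (b v : 'cV[R]_p) : 0 <= t <= 1 ->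
  lasso_pen n lambda (b + t *: (v - b)) <=
  lasso_pen n lambda b + t * (lasso_pen n lambda v - lasso_pen n lambda b).
Proof.
move=> /andP[t0 t1].
have -> : b + t *: (v - b) = (1 - t) *: b + t *: v.
  by apply/matrixP => i j; rewrite !mxE; ring.
have := l1norm_triangle ((1 - t) *: b) (t *: v).
rewrite !l1normZ !ger0_norm ?subr_ge0 // /lasso_pen => h.
have c0 : 0 <= Num.sqrt n%:R * lambda by rewrite mulr_ge0 ?sqrtr_ge0.
by apply: le_trans (ler_wpM2l c0 h) _; rewrite le_eqVlt; apply/orP; left; apply/eqP; ring.
Qed.

(* This is [X^T (y - X b) \in \partial h(b)], obtained by comparing [b] with
   [b + t (v - b)] as [t] tends to 0. *)
Lemma argmin_variational y b v : argmin (lasso_obj y) b ->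
  dot (y - X *m b) (X *m (v - b)) <= lasso_pen n lambda v - lasso_pen n lambda b.
Proof.
(* The constant is the quadratic term t^2 |X(v - b)|^2 of the objective after division by 2t. *)
move=> bmin; apply: (@ler_addM_small _ _ _ (dot (X *m (v - b)) (X *m (v - b)) / 2)).
move=> t /andP[t0 t1].
have := bmin (b + t *: (v - b)).
have := @lasso_pen_convex t b v; rewrite (ltW t0) t1 => /(_ isT).
rewrite /lasso_obj !sqr_l2norm mulmxDr -scalemxAr.
rewrite (addrAC (X *m b)) -[y - X *m b]opprB.
move: (X *m b - y) (X *m (v - b)) => r z; rewrite !dotE (dotC z r).
move: (lasso_pen n lambda _) => h hc hmin.
rewrite -subr_ge0 -(pmulr_rge0 _ t0); lra.
Qed.

(** Testing each minimizer's variational inequality at the other and adding cancels the penalties,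
    leaving |z|^2 <= (y - y') . z for z = X b - X b'. So the fit is a Lipschitz function of the data
    even when minimizers are not unique. *)
Lemma lasso_fit_lipschitz y y' b b' :
  argmin (lasso_obj y) b -> argmin (lasso_obj y') b' ->
  l2norm (X *m b - X *m b') <= l2norm (y - y').
Proof.
move=> bmin b'min.
have h1 := argmin_variational b' bmin; have h2 := argmin_variational b b'min.
have : dot (X *m b - X *m b') (X *m b - X *m b') <=
       dot (y - y') (X *m b - X *m b').
  by move: h1 h2; rewrite !mulmxBr; move: (X *m b) (X *m b') => z z';
     rewrite !dotE !(dotC z' z); lra.
move=> /le_trans/(_ (dot_le_l2norm _ _)); rewrite -sqr_l2norm.
have := l2norm_ge0 (X *m b - X *m b').
rewrite le_eqVlt => /predU1P[<- _|z0]; first exact: l2norm_ge0.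
by rewrite expr2 ler_pM2r.
Qed.

End Lasso.

(** Inside the cone the quotient is at least [r]; outside it the left side is nonpositive. For n = 0
    the left side vanishes. *)
Lemma compat_l1_bound (R : realType) (n p : nat) (X : 'M[R]_(n, p))
    (T : {set 'I_p}) (r : R) (v : 'cV[R]_p) :
  0 < r -> (r%:E <= compat X T 1)%E ->
  r * (Num.sqrt n%:R * (l1norm (restr T v) - l1norm (restr (~: T)%SET v))) <=
  Num.sqrt #|T|%:R * l2norm (X *m v).
Proof.
move=> r0 r_le.
have rhs0 : 0 <= Num.sqrt #|T|%:R * l2norm (X *m v).
  by rewrite mulr_ge0 ?sqrtr_ge0.
set D := l1norm _ - _; have [D0|D0] := leP D 0.
  by rewrite (le_trans _ rhs0) // !mulr_ge0_le0 ?sqrtr_ge0 // ltW.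
have [->|n0] := eqVneq (Num.sqrt n%:R : R) 0; first by rewrite mul0r mulr0.
have B0 : 0 < Num.sqrt n%:R * D by rewrite mulr_gt0 // lt_neqAle eq_sym n0 sqrtr_ge0.
rewrite -ler_pdivlMr // -lee_fin (le_trans r_le) //; apply: ereal_inf_lbound.
by exists v; rewrite /= ?invr1 !mul1r // -subr_gt0.
Qed.

Lemma lasso_signal_bias (R : realType) (n p : nat) (X : 'M[R]_(n, p))
    (lambda r s M : R) (T : {set 'I_p}) (u b : 'cV[R]_p) (e : 'cV[R]_n) :
  0 <= lambda -> 0 < r -> (r%:E <= compat X T 1)%E -> 0 < s ->
  l2norm e <= M -> 0 <= dot e (X *m u) ->
  let beta := (- s) *: restr T u in
  argmin (lasso_obj X lambda (X *m beta + e)) b ->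
  s * (lambda * (Num.sqrt n%:R *
         (l1norm (restr T u) - l1norm (restr (~: T)%SET u)))) -
    (M + lambda * Num.sqrt #|T|%:R / r) ^+ 2 / 4 <=
  s * (l2norm (X *m (b - beta)) * l2norm (X *m u)).
Proof.
move=> lambda0 r0 r_le s0 eM eu beta bmin.
set kap := Num.sqrt n%:R * _; set C := lambda * _ / r.
have supp_beta : supp beta \subset T.
  apply/fintype.subsetP => i; rewrite inE !mxE; case: ifP => //.
  by rewrite mulr0 eqxx.
have pen_b : lasso_pen n lambda beta - lasso_pen n lambda b <=
             C * l2norm (X *m (b - beta)).
  have eb : l1norm b = l1norm (beta + (b - beta)) by rewrite subrKC.
  rewrite /lasso_pen -mulrBr eb.
  have cB : r * (Num.sqrt n%:R * (l1norm beta - l1norm (beta + (b - beta)))) <=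
      Num.sqrt #|T|%:R * l2norm (X *m (b - beta)).
    apply: le_trans (compat_l1_bound (b - beta) r0 r_le).
    by rewrite ler_pM2l // ler_wpM2l ?sqrtr_ge0 // l1norm_decrease.
  rewrite -(ler_pM2l r0).
  have -> : r * (C * l2norm (X *m (b - beta))) =
      lambda * (Num.sqrt #|T|%:R * l2norm (X *m (b - beta))).
    by rewrite /C; field; rewrite gt_eqF.
  by have := ler_wpM2l lambda0 cB; lra.
have pen_v : lasso_pen n lambda (s *: restr (~: T)%SET u) -
    lasso_pen n lambda beta = - (s * (lambda * kap)).
  by rewrite /lasso_pen /beta !l1normZ normrN gtr0_norm // /kap; ring.
(* The test point s u_{T^c} equals [beta] + s u, so its displacement from [b] is s u - (b -
   beta). *)
have := argmin_variational lambda0 (s *: restr (~: T)%SET u) bmin.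
have -> : X *m (s *: restr (~: T)%SET u - b) =
    s *: (X *m u) - X *m (b - beta).
  rewrite scalemxAr -mulmxBr; congr (_ *m _); apply/matrixP => i j.
  by rewrite ord1 !mxE finset.in_setC; case: (i \in T) => /=; ring.
have -> : X *m beta + e - X *m b = e - X *m (b - beta).
  by rewrite mulmxBr opprB addrAC addrC addrA addrAC.
have ez := dot_le_l2norm e (X *m (b - beta)).
have zu := dot_le_l2norm (X *m (b - beta)) (X *m u).
move: pen_b pen_v ez zu; set z := X *m (b - beta) => pen_b pen_v ez zu.
have z0 := l2norm_ge0 z.
rewrite !dotE -sqr_l2norm => hb.
have := ler_wpM2r z0 eM => eMz.
have su0 : 0 <= s * dot e (X *m u) by rewrite mulr_ge0 // ltW.
have szu := ler_wpM2l (ltW s0) zu.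
(* Completing the square: |z|^2 - (M + C) |z| >= -(M + C)^2 / 4. *)
have := sqr_ge0 (l2norm z - (M + C) / 2).
lra.
Qed.

(** * Noise events: half-spaces, tightness, measurability *)

Section SymmetricNoise.
Variables (R : realType) (n : nat) (d : measure_display).
Variables (Omega : measurableType d) (P : probability Omega R).
Variable eps : {RV P >-> borel_cV R n}.

Lemma measurable_open_preimage (A : set 'cV[R]_n) :
  open A -> measurable [set w | A (eps w)].
Proof.
move=> oA; rewrite -[X in measurable X]setTI.
by apply: (@measurable_funPT _ _ _ _ eps) => //; exact: sub_sigma_algebra.
Qed.

Lemma measurable_closed_preimage (A : set 'cV[R]_n) :
  closed A -> measurable [set w | A (eps w)].
Proof.
move=> /closed_openC /measurable_open_preimage/measurableC.
by congr measurable; apply/seteqP; split => w /=; rewrite notK.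
Qed.

Lemma closed_halfspace (g : 'cV[R]_n) : closed [set e : 'cV[R]_n | 0 <= dot e g].
Proof.
apply: (@preimage_closed _ _ (fun e : 'cV[R]_n => dot e g) [set x | 0 <= x]).
  by move=> x _; exact: dot_continuous.
exact: closed_ge.
Qed.

(** The events eps . g >= 0 and -eps . g >= 0 cover [Omega] and are equally likely by symmetry. *)
Lemma symmetric_halfspace (g : 'cV[R]_n) : symmetric_rv eps ->
  ((1 / 2)%:E <= P [set w | (0 <= dot (eps w : 'cV[R]_n) g)%R])%E.
Proof.
move=> eps_sym; set A := [set e : 'cV[R]_n | 0 <= dot e g].
have mA : measurable [set w | A (eps w)].
  exact: measurable_closed_preimage (@closed_halfspace g).
have mB : measurable [set w | 0 <= dot (- (eps w : 'cV[R]_n)) g].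
  have -> : [set w | 0 <= dot (- (eps w : 'cV[R]_n)) g] =
      [set w | (0 <= dot (eps w : 'cV[R]_n) (- g))].
    by apply/seteqP; split => w /=; rewrite dotNl dotNr.
  exact: measurable_closed_preimage (@closed_halfspace (- g)).
have PAB : P [set w | A (eps w)] = P [set w | 0 <= dot (- (eps w : 'cV[R]_n)) g].
  have mA' : measurable (A : set (borel_cV R n)).
    by rewrite -(setCK A); apply: measurableC; apply: sub_sigma_algebra;
       exact: closed_openC (@closed_halfspace g).
  exact: eps_sym mA'.
have : (1 <= P [set w | A (eps w)] + P [set w | A (eps w)])%E.
  rewrite {2}PAB -(probability_setT P); apply: le_trans (measureU2 _ mA mB).
  apply: le_measure; rewrite ?inE //; first exact: measurableU.
  by move=> w _ /=; rewrite dotNl oppr_ge0; have [|/ltW] := leP 0 (dot (eps w : 'cV[R]_n) g); [left|right].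
rewrite -[P _ in X in X -> _]fineK ?fin_num_measure // -[P _ in X in _ -> X]fineK ?fin_num_measure //.
rewrite -EFinD !lee_fin; lra.
Qed.

Lemma measurable_l2norm_le (c : R) :
  measurable [set w | (l2norm (eps w : 'cV[R]_n) <= c)%R].
Proof.
apply: (@measurable_closed_preimage [set e | l2norm e <= c]).
have -> : [set e : 'cV[R]_n | l2norm e <= c] =
    (fun e => l2norm (e - 0)) @^-1` [set x | x <= c].
  by apply/seteqP; split => e /=; rewrite subr0.
apply: preimage_closed; first by move=> x _; exact: l2dist_continuous.
exact: closed_le.
Qed.

(** The events |eps| <= k increase to [Omega], so by continuity from below their probabilities tend
    to 1 and cannot all stay below [a]. *)
Lemma l2norm_tight (a : R) : a < 1 -> exists k : nat,
  (a%:E <= P [set w | (l2norm (eps w : 'cV[R]_n) <= k%:R)%R])%E.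
Proof.
move=> a1; apply: contrapT => /forallNP h.
pose F (k : nat) := [set w | l2norm (eps w : 'cV[R]_n) <= k%:R].
have mF k : measurable (F k) by exact: measurable_l2norm_le.
have FT : \bigcup_k F k = setT.
  apply/seteqP; split => // w _; exists (Num.truncn (l2norm (eps w : 'cV[R]_n))).+1 => //.
  by rewrite /F /=; apply/ltW/truncnS_gt.
have cvgF : P \o F @ \oo --> P (\bigcup_k F k).
  apply: nondecreasing_cvg_mu => //; first by rewrite FT.
  by move=> i j ij; apply/subsetPset => w /= /le_trans; apply; rewrite ler_nat.
have : (P (\bigcup_k F k) <= a%:E)%E.
  apply: (cvge_le _ cvgF); apply: nearW => k.
  by have /negP := h k; rewrite -ltNge => /ltW.
by rewrite FT probability_setT lee_fin leNgt a1.
Qed.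

(* Measurability of [f] is not assumed, but [f] is a Lipschitz function of [eps]
   on the range of [eps]: [f w < c] means that [eps w] lies in the union of the
   open balls of radius [c - f w'] around the [eps w'] with [f w' < c]. *)
Lemma measurable_lipschitz_ge (f : Omega -> R) (c : R) :
  (forall w w', f w - f w' <= l2norm ((eps w : 'cV[R]_n) - eps w')) ->
  measurable [set w | c <= f w].
Proof.
move=> f_lip.
pose U := \bigcup_(w' in [set w' | f w' < c])
  [set e : 'cV[R]_n | l2norm (e - eps w') < c - f w'].
have -> : [set w | c <= f w] = ~` [set w | U (eps w)].
  apply/seteqP; split => w /=.
    move=> cf [w' /= fw'] /=; apply/negP; rewrite -leNgt.
    by apply: le_trans (f_lip w w'); rewrite lerD2r.
  move=> nU; rewrite leNgt; apply/negP => fc; apply: nU; exists w => //=.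
  by rewrite subrr /l2norm big1 ?sqrtr0 ?subr_gt0 // => i _; rewrite mxE expr0n.
apply/measurableC/measurable_open_preimage/bigcup_open => w' _.
apply: (@open_comp _ _ (fun e : 'cV[R]_n => l2norm (e - eps w')) [set x | x < c - f w']).
  by move=> x _; exact: l2dist_continuous.
exact: open_lt.
Qed.

End SymmetricNoise.

Lemma compat_approx (R : realType) (n p : nat) (X : 'M[R]_(n, p))
    (T : {set 'I_p}) (r c : R) :
  0 < r -> 1 < c -> compat X T 1 = r%:E ->
  exists u : 'cV[R]_p,
    0 < Num.sqrt n%:R * (l1norm (restr T u) - l1norm (restr (~: T)%SET u)) /\
    Num.sqrt #|T|%:R * l2norm (X *m u) < c * r *
      (Num.sqrt n%:R * (l1norm (restr T u) - l1norm (restr (~: T)%SET u))).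
Proof.
move=> r0 c1 phiE.
have : (compat X T 1 < (c * r)%:E)%E by rewrite phiE lte_fin ltr_pMl.
move=> /ereal_inf_lt[_ [u /= u_cone <-]].
have : (r%:E <= ((Num.sqrt #|T|%:R * l2norm (X *m u)) / (Num.sqrt n%:R *
    (l1norm (restr T u) - 1^-1 * l1norm (restr (~: T)%SET u))))%:E)%E.
  by rewrite -phiE; apply: ereal_inf_lbound; exists u.
rewrite invr1 mul1r lee_fin lte_fin; set A := _ * l2norm _; set B := Num.sqrt n%:R * _.
move=> r_le AB; exists u; rewrite -/A -/B.
(* The case n = 0 is excluded through the convention x / 0 = 0: if [B] were 0 the quotient would be
   0, below [r]. *)
have B0 : 0 < B.
  have B_ge0 : 0 <= B.
    by rewrite mulr_ge0 ?sqrtr_ge0 // subr_ge0; move: u_cone; rewrite mul1r => /ltW.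
  rewrite lt_neqAle B_ge0 andbT eq_sym; apply/eqP => B0.
  by move: r_le; rewrite B0 invr0 mulr0 leNgt r0.
by split; rewrite // -ltr_pdivrMr.
Qed.

Theorem theorem4p1 (R : realType) (n p : nat) (X : 'M[R]_(n, p))
    (d : measure_display) (Omega : measurableType d) (P : probability Omega R)
    (eps : {RV P >-> borel_cV R n}) (eps_sym : symmetric_rv eps)
    (lambda : R) (lambda_ge0 : 0 <= lambda) (T : {set 'I_p})
    (phi_gt0 : (0 < compat X T 1)%E) :
  exists beta_star : 'cV[R]_p,
    supp beta_star \subset T /\
    forall beta_hat : Omega -> 'cV[R]_p,
      (forall w : Omega,
        let y : 'cV[R]_n := X *m beta_star + (eps w : 'cV[R]_n) in
        argmin (fun beta : 'cV[R]_p =>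
            l2norm (X *m beta - y) ^+ 2 + 2 * lasso_pen n lambda beta)
          (beta_hat w)) ->
      ((49 / 100)%:E <=
       P [set w | (99 / 100)%:E *
                  ((lambda * Num.sqrt #|T|%:R)%:E / compat X T 1) <=
                  (l2norm (X *m (beta_hat w - beta_star)))%:E])%E.

Proof.
case phiE : (compat X T 1) phi_gt0 => [r| |] //; last first.
  (* For phi = +oo the inverse is 0, so the lower bound is 0 and holds surely. *)
  move=> _; exists 0; split.
    by apply/fintype.subsetP => i; rewrite inE mxE eqxx.
  move=> b _; rewrite [X in P X](_ : _ = setT).
    by rewrite probability_setT lee_fin; lra.
  by apply/seteqP; split => // w _ /=; rewrite invey !mule0 lee_fin l2norm_ge0.
rewrite lte_fin => r0.
have setE (beta : 'cV[R]_p) (b : Omega -> 'cV[R]_p) :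
    [set w | ((99 / 100)%:E * ((lambda * Num.sqrt #|T|%:R)%:E / r%:E) <=
              (l2norm (X *m (b w - beta)))%:E)%E] =
    [set w | 99 / 100 * (lambda * Num.sqrt #|T|%:R / r) <=
             l2norm (X *m (b w - beta))].
  by apply/seteqP; split => w /=; rewrite inver gt_eqF // -!EFinM lee_fin.
(* Separated because [s] is chosen below by dividing by [lambda * B]. *)
have [lambda0|lambda_neq0] := eqVneq lambda 0.
  exists 0; split; first by apply/fintype.subsetP => i; rewrite inE mxE eqxx.
  move=> b _; rewrite setE [X in P X](_ : _ = setT).
    by rewrite probability_setT lee_fin; lra.
  by apply/seteqP; split => // w _ /=; rewrite lambda0 !mul0r mulr0 l2norm_ge0.
have lambda_gt0 : 0 < lambda by rewrite lt_neqAle eq_sym lambda_neq0.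
have r_le : (r%:E <= compat X T 1)%E by rewrite phiE.
(* Near-minimality costs a factor 0.995 and the error term another; 0.995^2 >= 0.99. *)
have [u []] := @compat_approx _ _ _ X T r (1000 / 995) r0 ltac:(lra) phiE.
set A := _ * l2norm _; set B := Num.sqrt n%:R * _ => B0 AB.
have [k Pk] := @l2norm_tight _ _ _ _ _ eps (99 / 100) ltac:(lra).
set C := lambda * Num.sqrt #|T|%:R / r.
have lB0 : 0 < lambda * B by rewrite mulr_gt0.
have dlB0 : 0 < 5 / 1000 * (lambda * B) by lra.
(* The error is made at most 0.5% of s lambda B; the added 1 keeps [s] positive even if the error is
   0. *)
have [s s0 s_large] : exists2 s, 0 < s &
    (k%:R + C) ^+ 2 / 4 <= s * (5 / 1000 * (lambda * B)).
  exists ((k%:R + C) ^+ 2 / 4 / (5 / 1000 * (lambda * B)) + 1); last first.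
    by rewrite mulrDl divfK ?gt_eqF // mul1r lerDl ltW.
  apply: ltr_wpDl ltr01; apply: divr_ge0; last exact: ltW.
  have := sqr_ge0 (k%:R + C); lra.
exists ((- s) *: restr T u); split.
  apply/fintype.subsetP => i; rewrite inE !mxE; case: ifP => //.
  by rewrite mulr0 eqxx.
move=> b b_min; rewrite setE -/C.
set S := [set w | _].
(* Two fits differ by at most |y - y'| = |eps w - eps w'|, so the loss is Lipschitz in the noise for
   any choice of minimizers. *)
have mS : measurable S.
  apply: (@measurable_lipschitz_ge _ _ _ _ _ eps) => w w'.
  have := l2norm_triangle (X *m (b w' - (- s) *: restr T u)) (X *m b w - X *m b w').
  have -> : X *m (b w' - (- s) *: restr T u) + (X *m b w - X *m b w') =
            X *m (b w - (- s) *: restr T u).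
    by rewrite -mulmxBr -mulmxDr addrC addrA subrK.
  rewrite -lerBlDl => /le_trans; apply.
  apply: le_trans (lasso_fit_lipschitz lambda_ge0 (b_min w) (b_min w')) _.
  by rewrite opprD addrACA subrr add0r.
pose K := [set w | (l2norm (eps w : 'cV[R]_n) <= k%:R)%R].
pose H := [set w | (0 <= dot (eps w : 'cV[R]_n) (X *m u))%R].
have mK : measurable K by exact: measurable_l2norm_le.
have mH : measurable H.
  exact: (@measurable_closed_preimage _ _ _ _ _ eps _ (@closed_halfspace _ _ (X *m u))).
have KHS : K `&` H `<=` S.
  move=> w [Kw Hw]; rewrite /S /=.
  have := @lasso_signal_bias _ _ _ X lambda r s k%:R T u (b w) (eps w) lambda_ge0 r0
    r_le s0 Kw Hw (b_min w).
  rewrite -/B -/C; set z := l2norm (X *m (_ - _)) => bias.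
  have z_ge : 995 / 1000 * (lambda * B) <= z * l2norm (X *m u).
    by rewrite -(ler_pM2l s0); lra.
  have Xu0 : 0 < l2norm (X *m u).
    rewrite lt_neqAle l2norm_ge0 andbT eq_sym; apply: contraTneq z_ge => ->.
    rewrite mulr0 -ltNge; lra.
  rewrite -(ler_pM2r Xu0); apply: le_trans z_ge.
  have -> : 99 / 100 * C * l2norm (X *m u) = 99 / 100 * lambda / r * A.
    by rewrite /C /A; ring.
  (* Near-minimality bounds C |Xu| by 1000/995 lambda B, and 0.99 * 1000/995 <= 0.995. *)
  have AB' : lambda / r * A <= lambda / r * (1000 / 995 * r * B).
    by rewrite ler_wpM2l ?divr_ge0 ?ltW.
  have eB : lambda / r * (1000 / 995 * r * B) = 1000 / 995 * (lambda * B).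
    by field; rewrite gt_eqF.
  rewrite eB in AB'; lra.
have PH := symmetric_halfspace (X *m u) eps_sym.
have mKH : measurable (K `&` H) by exact: measurableI.
apply: (@le_trans _ _ (P (K `&` H))); last by apply: le_measure; rewrite ?inE.
(* This yields P(K and H) >= 1/2 - 1/100 = 0.49, with no independence between the two events. *)
have : (P H <= P (K `&` H) + P (~` K))%E.
  apply: le_trans (measureU2 _ mKH (measurableC mK)).
  apply: le_measure; rewrite ?inE //; first by apply: measurableU => //; exact: measurableC.
  by move=> w Hw; have [Kw|Kw] := pselect (K w); [left|right].
rewrite probability_setC //; move: Pk PH; rewrite -/K -/H.
rewrite -(fineK (fin_num_measure P _ mK)) -(fineK (fin_num_measure P _ mH)).
rewrite -(fineK (fin_num_measure P _ mKH)) -EFinB -EFinD !lee_fin; lra.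
Qed.
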